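(* Let $\beta>1$ be real and suppose the $\beta$-shift $X_\beta$ is not sofic. Then for every positive integer $n$, $$\Phi_n(d_\beta^*(1))\le |E_{X_\beta}(n)|\le (n+1)\,\Phi_n(d_\beta^*(1)).$$
   Context: Let $\beta>1$ be real. For $x\in[0,1)$, $d_\beta(x)=.x_1x_2x_3\ldots$ is the lexicographically largest sequence over $\{0,1,\ldots,\lfloor\beta\rfloor\}$ with $x=\sum_{n\ge1}x_n\beta^{-n}$ (the greedy expansion, $x_i=\lfloor \beta\, T_\beta^{i-1}(x)\rfloor$ with $T_\beta(x)=\beta x \bmod 1$). The one-sided $\beta$-shift is $X_\beta=\overline{d_\beta([0,1))}$ (closure in the product topology). Put $d_\beta^*(1)=\lim_{x\nearrow 1}d_\beta(x)$. Equivalently (Parry), a sequence $x$ over $\{0,\ldots,\lfloor\beta\rfloor\}$ is in $X_\beta$ iff $\sigma^i(x)\preceq d_\beta^*(1)$ for all $i\ge 0$, where $\sigma$ is the left shift and $\preceq$ is lexicographic order. For a shift $X$, $L(X)$ is the set of finite words (including the empty word) appearing in points of $X$, and $L_n(X)$ is the set of those of length $n$. The extender set of $w\in L(X)$ is $E_X(w)=\{(s,u): s,u\in L(X),\ swu\in L(X)\}$. For a positive integer $n$, $E_X(n)=\{E_X(w): w\in L_n(X)\}$, so $|E_X(n)|$ is the number of distinct extender sets of words of length $n$. For a right-infinite sequence $d$, $\Phi_n(d)$ is the number of distinct words of length $n$ occurring as (contiguous) subwords of $d$. A shift is sofic if it is the image of a shift of finite type under a continuous shift-commuting map; equivalently,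 it has only finitely many distinct follower sets $F_X(w)=\{u\in L(X): wu\in L(X)\}$, $w\in L(X)$. It is known that $X_\beta$ is sofic iff $d_\beta^*(1)$ is eventually periodic. *)

(* Defs.v *)
From HB Require Import structures.
From mathcomp Require Import all_boot all_order all_algebra finmap.
From mathcomp Require Import all_classical all_reals all_analysis.
Set Implicit Arguments.
Unset Strict Implicit.
Unset Printing Implicit Defensive.
Import Order.TTheory GRing.Theory Num.Theory numFieldTopology.Exports.
Local Open Scope classical_set_scope.
Local Open Scope ring_scope.

(* Letters are natural numbers, words are lists, and right-infinite sequences
   are indexed from 0, with the product topology of the discrete topology on
   [nat]. Finite alphabets are encoded as initial segments of [nat]; the
   sequences over such an alphabet form a closed set, whose subspace topology
   is the usual product topology. *)
Definition infword := {ptws nat -> nat}.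

HB.instance Definition _ := Uniform.copy infword {ptws nat -> nat}.
HB.instance Definition _ := isPointed.Build infword (fun=> 0%N).

Definition sigma (x : infword) : infword := fun i => x i.+1.

Definition factor (x : infword) (i n : nat) : seq nat :=
  mkseq (fun j => x (i + j)%N) n.

Definition occurs (x : infword) (w : seq nat) : Prop :=
  exists i, factor x i (size w) = w.

(* The cardinal of a finite set; [fset_set] is only meaningful on finite sets,
   which is the case below because the alphabets are finite. *)
Definition set_card (T : choiceType) (A : set T) : nat := #|` fset_set A|.

Definition complexity (n : nat) (d : infword) : nat :=
  set_card [set w | size w = n /\ occurs d w].

Definition language (X : set infword) : set (seq nat) :=
  [set w | exists2 x, X x & occurs x w].

Definition language_n (X : set infword) (n : nat) : set (seq nat) :=
  [set w | language X w /\ size w = n].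

Definition extender (X : set infword) (w : seq nat) :
    set (seq nat * seq nat) :=
  [set su | [/\ language X su.1, language X su.2
             & language X (su.1 ++ w ++ su.2)]].

Definition extender_sets (X : set infword) (n : nat) :
    set (set (seq nat * seq nat)) :=
  extender X @` language_n X n.

(* The one-sided shift over the alphabet {0, ..., k-1} given by the finite
   list [F] of forbidden words. *)
Definition sft (k : nat) (F : seq (seq nat)) : set infword :=
  [set x | (forall i, (x i < k)%N) /\ (forall w, w \in F -> ~ occurs x w)].

Definition sofic (X : set infword) : Prop :=
  exists k F (f : infword -> infword),
    [/\ {within sft k F, continuous f},
        (forall y, sft k F y -> f (sigma y) = sigma (f y))
      & f @` sft k F = X].

Definition lex_le (s t : infword) : Prop :=
  s = t \/ exists k, (forall i, (i < k)%N -> s i = t i) /\ (s k < t k)%N.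

Section BetaShift.
Context {R : realType}.
Implicit Types (beta x : R).

(* The digit [s n] has weight [beta ^- n.+1] because indices start at 0. *)
Definition representation beta x : set infword :=
  [set s | (forall n, (s n <= Num.truncn beta)%N) /\
    series (fun n => (s n)%:R * beta ^- n.+1) @ \oo --> x].

(* [xget] picks the (unique) lexicographically largest representation; the
   default value is irrelevant when 1 < beta and 0 <= x < 1, where such a
   representation exists, namely the greedy expansion. *)
Definition d_ beta x : infword :=
  xget (fun=> 0%N) [set s | representation beta x s /\
    forall t, representation beta x t -> lex_le t s].

Definition beta_shift beta : set infword :=
  closure (d_ beta @` [set x | 0 <= x < 1]).

Definition dstar beta : infword := lim (d_ beta x @[x --> 1^'-]).

End BetaShift.

(* Main.v *)
(* Write d for d*(1), S for the set of its factors of length n, and compare words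
   lexicographically. A word w is in the language iff each of its suffixes t
   satisfies t <= d[0,|t|).

   Lower bound: if v < w are in S and v = d[i,i+n), then d[0,i) v is in the
   language but d[0,i) w is not, so distinct elements of S have distinct extender
   sets.

   Upper bound: whether swu is in the language is tested on the suffixes of swu.
   Those that start inside s compare w with elements of S; those that start
   inside w only matter when they start with a suffix of w that is a prefix of d.
   Hence the extender set of w is determined by the number of elements of S below
   w (fewer than |S|), together with w itself if w is in S and with the longest
   suffix of w that is a prefix of d otherwise (at most n possibilities, since
   this suffix is then not w). *)
Require Import Defs.
From mathcomp Require Import all_boot all_order all_algebra finmap.
From mathcomp Require Import all_classical all_reals all_analysis.
Set Implicit Arguments.
Unset Strict Implicit.
Unset Printing Implicit Defensive.
Import Order.TTheory GRing.Theory Num.Theory numFieldTopology.Exports.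
Local Open Scope classical_set_scope.
Local Open Scope ring_scope.

Local Notation factor := Defs.factor.
Local Notation "u <=w v" := (@Order.le _ (seqlexi nat) u v) (at level 70).
Local Notation "u <w v" := (@Order.lt _ (seqlexi nat) u v) (at level 70).

(** * Lexicographic order on words, admissibility, and a counting bound *)

Lemma lexi_cat (s t w v : seq nat) : size s = size t ->
  (s ++ w <=w t ++ v) = (s <w t) || (s == t) && (w <=w v).
Proof.
elim: s t => [|a s IHs] [|b t] //= [st].
rewrite lexi_cons ltxi_cons IHs// eqseq_cons.
case: (ltngtP a b) => ab /=;
  by rewrite ?leEnat ?ab ?leqnn ?(ltnW ab) ?(leqNgt b a) ?(leqNgt a b) ?ab.
Qed.

Lemma lexi_cat2l (s w v : seq nat) : (s ++ w <=w s ++ v) = (w <=w v).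
Proof. by rewrite lexi_cat// ltxx eqxx. Qed.

Lemma size_factor x i n : size (factor x i n) = n.
Proof. exact: size_mkseq. Qed.

Lemma factor_cat x i m n :
  factor x i (m + n) = factor x i m ++ factor x (i + m) n.
Proof.
have iotaE := iotaDl m 0 n; rewrite addn0 in iotaE.
rewrite /factor /mkseq iotaD map_cat add0n iotaE -map_comp.
by congr (_ ++ _); apply: eq_map => j /=; rewrite addnA.
Qed.

(** Parry's criterion for finite words: each condition on a shifted sequence is cut off at the end
    of the word. *)
Definition admissible (d : infword) (w : seq nat) :=
  forall s t, w = s ++ t -> t <=w factor d 0 (size t).

Lemma admissible_catr d s t : admissible d (s ++ t) -> admissible d t.
Proof. by move=> adm a b tE; apply: (adm (s ++ a)); rewrite tE catA. Qed.

(** The pair [(g1 x, g2 x)] is coded by the number [g1 x * m2 + g2 x], which is below [m1 * m2] and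
    determines [f x]. *)
Lemma set_card_image (T U : choiceType) (f : T -> U)
    (g1 g2 : T -> nat) (A : set T) (m1 m2 : nat) :
    (forall x, A x -> (g1 x < m1)%N /\ (g2 x < m2)%N) ->
    (forall x y, A x -> A y -> g1 x = g1 y -> g2 x = g2 y -> f x = f y) ->
  (set_card (f @` A) <= m1 * m2)%N.
Proof.
move=> gm fg; have [->|/set0P[x0 _]] := eqVneq A set0.
  by rewrite image_set0 /set_card fset_set0.
pose g x := (g1 x * m2 + g2 x)%N.
pose h k := f (xget x0 [set x | A x /\ g x = k]).
have fE : f @` A = h @` (g @` A).
  rewrite image_comp; apply: eq_imagel => x Ax /=.
  rewrite /h; case: xgetP => [y _ [Ay gy]|/(_ x)]; last by case.
  (* Division by [m2] recovers both components from the code. *)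
  have := congr1 (edivn^~ m2) gy.
  have [[_ xm] [_ ym]] := (gm _ Ax, gm _ Ay).
  by rewrite !edivn_eq// => -[gy1 gy2]; exact: fg.
apply: geq_card_fset_set; rewrite fE.
apply: card_le_trans (card_image_le _ _) _; apply: subset_card_le.
move=> _ [x Ax <-] /=; have [x1 x2] := gm _ Ax.
apply: leq_trans (_ : (g1 x).+1 * m2 <= _)%N; last by rewrite leq_mul2r x1 orbT.
by rewrite mulSn [(m2 + _)%N]addnC ltn_add2l.
Qed.

Lemma cat_split (T : Type) (s t a b : seq T) : s ++ t = a ++ b ->
  (exists2 c, s = a ++ c & b = c ++ t) \/ (exists2 c, a = s ++ c & t = c ++ b).
Proof.
elim: s a => [|x s IHs] [|y a] /= E.
- by left; exists [::].
- by right; exists (y :: a).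
- by left; exists (x :: s).
- case: E => -> /IHs[[c -> ->]|[c -> ->]]; first by left; exists c.
  by right; exists c.
Qed.

(** * Extender sets when the language is given by admissibility: the lower bound *)

Section Extenders.
Variables (X : set infword) (d : infword) (n : nat).
Hypothesis languageE : forall w, language X w <-> admissible d w.
Hypothesis language_factor : forall i m, language X (factor d i m).

Let S : set (seq nat) := [set w | size w = n /\ occurs d w].

Let S_factor w : S w <-> exists i, w = factor d i n.
Proof.
split=> [[<- [i iw]]|[i ->]]; first by exists i.
by split; [rewrite size_factor|exists i; rewrite size_factor].
Qed.

Let S_language : S `<=` language_n X n.
Proof. by move=> w /S_factor[i ->]; split=> //; exact: size_factor. Qed.

Lemma language_letter w a : language X w -> a \in w -> (a <= d 0)%N.
Proof.
move=> /languageE adm /path.splitPr wE; case: wE adm => s t adm.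
by have /lexi_lehead := adm _ _ erefl.
Qed.

Lemma finite_language_n : finite_set (language_n X n).
Proof.
pose f (t : n.-tuple 'I_(d 0).+1) := map val t.
apply: (@sub_finite_set _ _ (f @` setT)); last exact: finite_image.
move=> w [Lw wn]; have szw : size (map (@inord (d 0)) w) == n.
  by rewrite size_map wn.
exists (Tuple szw) => //=; rewrite /f /= -map_comp map_id_in// => a aw /=.
by rewrite inordK// ltnS; exact: language_letter Lw aw.
Qed.

Let finS : finite_set S.
Proof. exact: sub_finite_set S_language finite_language_n. Qed.

Lemma extender_factor_neq i j :
  factor d i n <w factor d j n ->
  extender X (factor d i n) <> extender X (factor d j n).
Proof.
move=> lt_ij; have : extender X (factor d i n) (factor d 0 i, [::]).
  split=> //=; first exact: (language_factor 0 0).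
  by rewrite cats0 -[X in factor d X n]add0n -factor_cat.
move=> + eq_ij; rewrite eq_ij => -[_ _] /=.
rewrite cats0 => /languageE /(_ [::] _ erefl).
rewrite size_cat !size_factor factor_cat lexi_cat2l add0n.
by rewrite leNgt lt_ij.
Qed.

Lemma extender_injective : {in S &, injective (extender X)}.
Proof.
move=> v w; rewrite !inE => /S_factor[i ->] /S_factor[j ->] eq_ij.
case: (ltgtP (factor d i n : seqlexi nat) (factor d j n)) => //.
- by move=> /extender_factor_neq /(_ eq_ij).
- by move=> /extender_factor_neq /(_ (esym eq_ij)).
Qed.

Lemma complexity_le_extender_sets :
  (complexity n d <= set_card (extender_sets X n))%N.
Proof.
rewrite /complexity -/S /set_card.
rewrite (_ : #|` fset_set S| = #|` fset_set (extender X @` S)|); last first.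
  rewrite fset_set_image// card_in_imfset// => v w.
  by rewrite !in_fset_set//; exact: extender_injective.
apply: fsubset_leq_card; rewrite -fset_set_sub; first exact: image_subset.
  exact: finite_image.
exact/finite_image/finite_language_n.
Qed.

(** * Suffixes that are prefixes of [d], and the upper bound *)

Lemma cut_exists (w : seq nat) : exists i, drop i w == factor d 0 (size w - i).
Proof. by exists (size w); rewrite drop_size subnn. Qed.

(* [drop (cut w) w] is the longest suffix of [w] that is a prefix of [d]. *)
Definition cut (w : seq nat) : nat := ex_minn (cut_exists w).

Lemma cut_size w : (cut w <= size w)%N.
Proof.
by rewrite /cut; case: ex_minnP => i _; apply; rewrite drop_size subnn.
Qed.

Lemma drop_cut w : drop (cut w) w = factor d 0 (size w - cut w).
Proof. by rewrite /cut; case: ex_minnP => i /eqP. Qed.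

Lemma cut_min s t : t = factor d 0 (size t) -> (cut (s ++ t) <= size s)%N.
Proof.
move=> tE; rewrite /cut; case: ex_minnP => i _; apply.
by rewrite drop_size_cat// size_cat addKn -tE.
Qed.

(** By minimality of [cut], [t] is a suffix of the longest suffix of [s ++ t] that is a prefix of
    [d]. The word [w] ends in that same word, since a prefix of [d] is determined by its length. *)
Lemma cut_suffix w s t : size w = size (s ++ t) -> cut w = cut (s ++ t) ->
  t = factor d 0 (size t) -> exists r, w = r ++ t.
Proof.
move=> szw cw tE; exists (take (cut w) w ++ drop (cut w) s).
rewrite -{1}(cat_take_drop (cut w) w) -catA; congr (_ ++ _).
rewrite drop_cut szw cw -drop_cut drop_cat.
have := cut_min s tE; rewrite leq_eqVlt => /orP[/eqP->|->//].
by rewrite ltnn subnn drop_size drop0.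
Qed.

Lemma extender_subset w w' :
    language_n X n w -> language_n X n w' -> cut w = cut w' ->
    (forall v, S v -> w <=w v -> w' <=w v) ->
    (S w' -> w = w') ->
  extender X w `<=` extender X w'.
Proof.
move=> [_ szw] [/languageE adm' szw'] cw le_ww' eq_ww' [s u].
move=> [/= Ls Lu /languageE adm]; split=> //=; apply/languageE => a b.
have le_fst c : admissible d c -> c <w factor d 0 (size c) \/
    c = factor d 0 (size c).
  move=> /(_ [::] c erefl); rewrite le_eqVlt => /orP[/eqP ->|->]; last by left.
  by right; rewrite size_factor.
(* The suffix [b] of [s ++ w' ++ u] starts inside [s], inside [w'], or inside [u]. *)
case/cat_split => [[c sE ->]|[c _ /cat_split[[c' w'E ->]|[c' cE uE]]]].
- rewrite !size_cat szw' !factor_cat lexi_cat ?size_factor//.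
  have {}admc : admissible d c.
    by move/languageE: Ls; rewrite sE; exact: admissible_catr.
  case: (le_fst c admc) => [->//|cE]; apply/orP; right; rewrite -cE eqxx/=.
  have := adm a (c ++ w ++ u); rewrite sE -catA => /(_ erefl).
  rewrite !size_cat szw !factor_cat -cE lexi_cat2l add0n.
  rewrite !lexi_cat ?size_factor//.
  (* As [c] is a prefix of [d], both [w] and [w'] face the factor [v] of [d] that follows it. *)
  set v := factor d (size c) n.
  have Sv : S v by apply/S_factor; exists (size c).
  case/orP => [lt_wv|/andP[/eqP wv le_u]].
    (* If [w' = v], then [w'] lies in [S], so [w = w' = v], against [w < v]. *)
    have := le_ww' v Sv (ltW lt_wv); rewrite le_eqVlt => /orP[/eqP w'v|->//].
    by move: lt_wv; rewrite eq_ww' w'v ?ltxx.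
  have := le_ww' v Sv; rewrite wv lexx => /(_ isT).
  by rewrite le_eqVlt => /orP[->|->//]; rewrite le_u orbT.
- have admc : admissible d c'.
    by move: adm'; rewrite w'E; exact: admissible_catr.
  case: (le_fst c' admc) => [lt_c'|c'E].
    by rewrite size_cat factor_cat lexi_cat ?size_factor// lt_c'.
  (* Here [c'] is a prefix of [d], hence also a suffix of [w]; so [c' ++ u] is a suffix of
     [s ++ w ++ u], where the inequality is known. *)
  have [||r wE] := @cut_suffix w c c' _ _ c'E; rewrite -?w'E ?szw//.
  by apply: (adm (s ++ r)); rewrite wE -!catA.
- by move/languageE: Lu; apply; rewrite uE.
Qed.

Let below (w : seq nat) : set (seq nat) := [set v | S v /\ v <w w].

Let finite_below w : finite_set (below w).
Proof. by apply: sub_finite_set finS => v []. Qed.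

(** The prefix of [d] of length [n] is in [S] but not below [w], because [w] is admissible. *)
Let below_lt w : language_n X n w -> (set_card (below w) < complexity n d)%N.
Proof.
move=> [/languageE adm szw]; apply: fproper_ltn_card.
rewrite fproperEneq; apply/andP; split; last by rewrite -fset_set_sub// => v [].
apply/eqP => /(fset_set_inj (finite_below w) finS) bS.
have : below w (factor d 0 n) by rewrite bS; apply/S_factor; exists 0%N.
by case=> _; rewrite ltNge -szw (adm [::]).
Qed.

(** The order is total, so these sets are nested, and nested finite sets of equal size coincide. *)
Let below_eq w w' : set_card (below w) = set_card (below w') ->
  below w = below w'.
Proof.
wlog ww' : w w' / w <=w w' => [wl|].
  case/orP: (le_total (w : seqlexi nat) w') => [|ww' E]; first exact: wl.
  by apply/esym/wl.
move=> E; apply: fset_set_inj => //; apply/eqP; rewrite eqEfcard.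
apply/andP; split; last by rewrite leq_eqVlt; apply/orP; left; apply/eqP.
rewrite -fset_set_sub// => v [Sv vw]; split=> //.
exact: lt_le_trans ww'.
Qed.

Let below_le w w' v : below w = below w' -> S v -> w <=w v -> w' <=w v.
Proof.
move=> E Sv; rewrite !leNgt; apply: contra => vw'.
by have : below w' v by []; rewrite -E => -[].
Qed.

Lemma extender_sets_le_complexity :
  (set_card (extender_sets X n) <= n.+1 * complexity n d)%N.
Proof.
(* [cut w] is positive when [w] is not in [S], so 0 can encode membership. *)
pose state w := if `[< S w >] then 0%N else cut w.
apply: (@set_card_image _ _ (extender X) state (fun w => set_card (below w))).
  move=> w Lw; split; last exact: below_lt.
  rewrite /state; case: ifP => // _; rewrite ltnS -Lw.2; exact: cut_size.
suff sub w w' : language_n X n w -> language_n X n w' -> state w = state w' ->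
    set_card (below w) = set_card (below w') -> extender X w `<=` extender X w'.
  by move=> w w' Lw Lw' sE bE; apply/seteqP; split; apply: sub.
have cut0 x : language_n X n x -> cut x = 0%N -> S x.
  move=> Lx cx; apply/S_factor; exists 0%N.
  by rewrite -[x in LHS]drop0 -[in LHS]cx drop_cut cx subn0 Lx.2.
move=> Lw Lw' sE /below_eq bE.
have SE : S w <-> S w'.
  move: sE; rewrite /state; case: asboolP => Sw; case: asboolP => Sw' // cE.
    by split=> // _; exact: cut0.
  by split=> // _; exact: cut0.
(* Of two distinct elements of [S], the smaller is below the larger but not below itself. *)
have eq_ww' : S w' -> w = w'.
  move=> Sw'; have Sw := SE.2 Sw'; apply/eqP.
  case: (ltgtP (w : seqlexi nat) w') => // [lt_ww'|lt_w'w].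
    by have : below w' w by []; rewrite -bE => -[_]; rewrite ltxx.
  by have : below w w' by []; rewrite bE => -[_]; rewrite ltxx.
have [Sw'|nSw'] := pselect (S w'); first by rewrite (eq_ww' Sw').
apply: extender_subset => //; last by move=> v; exact: below_le.
by move: sE; rewrite /state; case: asboolP => [/SE|_]//; case: asboolP.
Qed.

End Extenders.

(** * Greedy expansions in base [beta] *)

Lemma lex_le_anti (s t : infword) : lex_le s t -> lex_le t s -> s = t.
Proof.
case=> [//|[k [eq_k lt_k]]] [//|[l [eq_l lt_l]]].
case: (ltngtP k l) => kl.
- by move: lt_k; rewrite eq_l// ltnn.
- by move: lt_l; rewrite eq_k// ltnn.
- by move: lt_l; rewrite -kl ltnNge (ltnW lt_k).
Qed.

Lemma factor_cons (x : infword) i n :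
  factor x i n.+1 = x i :: factor x i.+1 n.
Proof. by rewrite -add1n factor_cat addn1 /factor /= addn0. Qed.

Lemma eq_factor (x y : infword) i j n :
  (forall k, (k < n)%N -> x (i + k)%N = y (j + k)%N) ->
  factor x i n = factor y j n.
Proof.
move=> xy; apply: (@eq_from_nth _ 0%N); rewrite ?size_factor// => k kn.
by rewrite !nth_mkseq// xy.
Qed.

Section Greedy.
Variables (R : realType) (beta : R).
Hypothesis beta_gt1 : 1 < beta.

Let beta_gt0 : 0 < beta. Proof. exact: lt_trans beta_gt1. Qed.

Definition beta_map (x : R) : R := beta * x - (Num.truncn (beta * x))%:R.

Definition greedy (x : R) : infword :=
  fun n => Num.truncn (beta * iter n beta_map x).

Lemma beta_map_itv x : 0 <= x -> 0 <= beta_map x < 1.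
Proof.
move=> x0; have bx0 : 0 <= beta * x by rewrite mulr_ge0// ltW.
rewrite /beta_map subr_ge0 ltrBlDl.
by have := truncn_itv bx0; rewrite -natr1.
Qed.

Lemma iter_beta_map_itv x n : 0 <= x < 1 -> 0 <= iter n beta_map x < 1.
Proof.
move=> x01; case: n => [//|n]; rewrite iterS.
elim: n => [|n /andP[ge0 _]]; last exact: beta_map_itv.
by case/andP: x01 => ? _; exact: beta_map_itv.
Qed.

Lemma greedy_iter x m n : greedy (iter m beta_map x) n = greedy x (m + n)%N.
Proof. by rewrite /greedy addnC iterD. Qed.

Lemma factor_greedy_iter x m n :
  factor (greedy x) m n = factor (greedy (iter m beta_map x)) 0 n.
Proof. by apply: eq_factor => k _; rewrite greedy_iter. Qed.

Lemma greedy_sum x n :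
  x = series (fun i => (greedy x i)%:R * beta ^- i.+1) n
      + beta ^- n * iter n beta_map x.
Proof.
elim: n => [|n IHn].
  by rewrite seriesEnat/= big_geq// expr0 invr1 add0r mul1r.
rewrite {1}IHn seriesSr -addrA; congr (_ + _).
rewrite iterS {2}/beta_map -/(greedy x n) /= [X in _ = X + _]mulrC -mulrDr.
rewrite addrC subrK mulrA exprSr invfM divfK//.
by rewrite gt_eqF.
Qed.

Lemma d_greedy x : 0 <= x < 1 -> d_ beta x = greedy x.
Proof.
move=> x01.
have rep_greedy : representation beta x (greedy x).
  split=> [n|].
    apply: le_truncn; rewrite -[leRHS]mulr1 ler_pM2l//.
    by case/andP: (iter_beta_map_itv n x01) => _ /ltW.
  have expr_cvg0 : beta ^- n @[n --> \oo] --> (0 : R).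
    under eq_fun do rewrite -exprVn.
    by apply: cvg_expr; rewrite ger0_norm ?invr_ge0 ?ltW// invf_lt1.
  have xE n := greedy_sum x n.
  (* The remainder after [n] digits lies between 0 and [beta ^- n]. *)
  apply: (@squeeze_cvgr _ _ _ _ (fun n => x - beta ^- n) (fun=> x)).
  - apply: nearW => n; have /andP[r0 r1] := iter_beta_map_itv n x01.
    have bn0 : 0 <= beta ^- n by rewrite invr_ge0 exprn_ge0// ltW.
    apply/andP; split; last by rewrite [leRHS](xE n) lerDl mulr_ge0.
    by rewrite lerBlDr [leLHS](xE n) lerD2l ler_piMr// ltW.
  - by rewrite -[X in _ --> X]subr0; apply: cvgB => //; exact: cvg_cst.
  - exact: cvg_cst.
have max_greedy t : representation beta x t -> lex_le t (greedy x).
  move=> [_ t_cvg].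
  have [|/existsNP neq] := pselect (forall k, t k = greedy x k).
    by move=> tE; left; apply/funext.
  have {}neq : exists k, t k != greedy x k.
    by case: neq => k /eqP; exists k.
  case: (ex_minnP neq) => k neq_k min_k; right; exists k.
  have eq_lt i : (i < k)%N -> t i = greedy x i.
    by move=> ik; apply/eqP; apply: contraTT ik => /min_k; rewrite -leqNgt.
  split=> //; rewrite ltn_neqAle neq_k /=.
  (* At the first difference [k], the later terms of [t] are nonnegative, so its digit [t k] must
     fit into the greedy remainder: [t k <= beta * iter k beta_map x]. The greedy digit is the
     largest such integer. *)
  have le_x : series (fun i => (t i)%:R * beta ^- i.+1) k.+1 <= x.
    have nd : nondecreasing_seq (series (fun i => (t i)%:R * beta ^- i.+1)).
      apply: nondecreasing_series => i _ _.
      by rewrite mulr_ge0// invr_ge0 exprn_ge0// ltW.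
    have := nondecreasing_cvgn_le nd (cvgP _ t_cvg) k.+1.
    by rewrite (cvg_lim _ t_cvg).
  have sumE : series (fun i => (t i)%:R * beta ^- i.+1) k =
      series (fun i => (greedy x i)%:R * beta ^- i.+1) k.
    rewrite !seriesEnat /=; apply: eq_big_nat => i /andP[_ ik].
    by rewrite eq_lt.
  move: le_x; rewrite seriesSr sumE {2}(greedy_sum x k) lerD2l => le_k.
  have /andP[r0 _] := iter_beta_map_itv k x01.
  rewrite /greedy truncn_ge_nat ?mulr_ge0 ?(ltW beta_gt0)//.
  move: le_k; rewrite exprSr invfM mulrCA ler_pM2l ?invr_gt0 ?exprn_gt0//.
  by rewrite ler_pdivrMr// mulrC.
rewrite /d_; case: xgetP => [s _ [rep_s max_s]|/(_ (greedy x))].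
  by apply: lex_le_anti; [exact: max_greedy|exact: max_s].
by case.
Qed.

(** The first digit is monotone in the point, and [beta_map] is monotone among points with the same
    first digit. *)
Lemma greedy_homo n x y : 0 <= x -> x <= y ->
  factor (greedy x) 0 n <=w factor (greedy y) 0 n.
Proof.
elim: n x y => [//|n IHn] x y x0 xy.
rewrite !factor_cons !(factor_greedy_iter _ 1) lexi_cons.
have bxy : beta * x <= beta * y by rewrite ler_pM2l.
have le_trunc := le_truncn bxy.
rewrite [X in X && _]le_trunc /=; apply/implyP => ge_trunc.
apply: IHn; first by case/andP: (beta_map_itv x0).
rewrite /beta_map lerB// ler_nat//.
Qed.

(** * The quasi-greedy expansion of 1 as the limit [dstar beta] *)

(* [ceil z - 1] when [0 < z]. *)
Definition quasi_digit (z : R) : nat :=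
  if (Num.truncn z)%:R == z then (Num.truncn z).-1 else Num.truncn z.

Lemma quasi_digit_itv z : 0 < z ->
  (quasi_digit z)%:R < z <= (quasi_digit z).+1%:R.
Proof.
move=> z0; have /andP[le_z lt_z] := truncn_itv (ltW z0).
rewrite /quasi_digit; case: eqP => [E|/eqP NE]; last first.
  by rewrite lt_neqAle NE le_z ltW.
have tz : (0 < Num.truncn z)%N by rewrite -(ltr_nat R) E.
by rewrite prednK// E lexx andbT -{2}E ltr_nat prednK.
Qed.

(** The left-continuous variant of [beta_map], with values in (0, 1] instead of [0, 1) for
    [0 < x]. *)
Definition quasi_map (x : R) : R := beta * x - (quasi_digit (beta * x))%:R.

(* Parry's quasi-greedy expansion of 1. *)
Definition quasi_greedy : infword :=
  fun n => quasi_digit (beta * iter n quasi_map 1).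

Lemma quasi_map_itv n : 0 < iter n quasi_map 1 <= 1.
Proof.
elim: n => [|n /andP[gt0 _]]; first by rewrite lexx ltr01.
have /quasi_digit_itv : 0 < beta * iter n quasi_map 1 by rewrite mulr_gt0.
by rewrite iterS /quasi_map subr_gt0 lerBlDr -natr1 addrC.
Qed.

(** While the digits agree, the orbit of [x] trails the quasi-greedy orbit of 1 by a gap that [beta]
    multiplies at each step; a small enough initial gap keeps [n] digits equal. *)
Lemma greedy_near1 n : exists2 e, 0 < e & forall x, 1 - e <= x < 1 -> 0 <= x ->
  (forall i, (i < n)%N -> greedy x i = quasi_greedy i) /\
  iter n beta_map x = iter n quasi_map 1 - beta ^+ n * (1 - x).
Proof.
elim: n => [|n [e e0 IHn]].
  by exists 1 => // x _ _; split=> //=; rewrite expr0 mul1r opprB addrC subrK.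
have bn0 : 0 < beta ^+ n.+1 by rewrite exprn_gt0.
have /andP[t0 _] := quasi_map_itv n.+1.
(* The next digit agrees once the gap [beta ^+ n.+1 * (1 - x)] is at most [iter n.+1 quasi_map 1],
   which is positive. *)
exists (Num.min e (iter n.+1 quasi_map 1 / beta ^+ n.+1)).
  by rewrite lt_min e0 divr_gt0.
move=> x /andP[xe x1] x0.
have [|eq_n iter_n] := IHn x _ x0.
  by rewrite x1 andbT (le_trans _ xe)// lerB// ge_min lexx.
have digit_n : greedy x n = quasi_greedy n.
  have /andP[_ tn] : (quasi_greedy n)%:R < beta * iter n quasi_map 1
      <= (quasi_greedy n).+1%:R.
    apply: quasi_digit_itv; rewrite mulr_gt0//.
    by case/andP: (quasi_map_itv n).
  rewrite /greedy iter_n; apply: truncn_def; rewrite mulrBr mulrA -exprS.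
  apply/andP; split; last first.
    by apply: lt_le_trans tn; rewrite gtrBl mulr_gt0// subr_gt0.
  rewrite lerBrDr addrC -lerBrDr -[leRHS]/(iter n.+1 quasi_map 1).
  rewrite -ler_pdivlMl// mulrC lerBlDr addrC -lerBlDr (le_trans _ xe)// lerB//.
  by rewrite ge_min lexx orbT.
split=> [i|].
  by rewrite ltnS leq_eqVlt => /orP[/eqP->//|]; exact: eq_n.
rewrite !iterS {1}/beta_map -/(greedy x n) digit_n iter_n /quasi_map.
by rewrite mulrBr mulrA -exprS addrAC.
Qed.

Lemma cvg_greedy : d_ beta x @[x --> 1^'-] --> quasi_greedy.
Proof.
apply/pointwise_cvgP => i; apply: cvg_near_cst.
have [e e0 near1] := greedy_near1 i.+1.
suff near_i : \forall x \near 1^'-, d_ beta x i = quasi_greedy i.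
  exact: near_i.
near=> x.
have x0 : 0 <= x by near: x; exact: nbhs_left_ge.
have x1 : x < 1 by near: x; exact: nbhs_left_lt.
rewrite d_greedy ?x0//; apply: (near1 x _ x0).1 => //; rewrite x1 andbT.
by near: x; apply: nbhs_left_ge; rewrite gtrBl.
Unshelve. all: by end_near. Qed.

Lemma dstarE : dstar beta = quasi_greedy.
Proof.
apply: cvg_lim; last exact: cvg_greedy.
by apply: hausdorff_product => _; exact: discrete_hausdorff.
Qed.

Lemma factor_quasi_greedy n : exists x, [/\ 0 <= x < 1,
  factor (greedy x) 0 n = factor quasi_greedy 0 n &
  forall y, 0 <= y < 1 -> factor (greedy y) 0 n <=w factor quasi_greedy 0 n].
Proof.
have [e e0 near1] := greedy_near1 n.
have fE x : 1 - e <= x < 1 -> 0 <= x ->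
    factor (greedy x) 0 n = factor quasi_greedy 0 n.
  by move=> xe x0; apply: eq_factor => k; apply: (near1 _ xe x0).1.
have m01 : 0 <= Num.max 0 (1 - e) < 1.
  by rewrite le_max lexx gt_max ltr01 gtrBl.
exists (Num.max 0 (1 - e)); split=> //.
  apply: fE; last by case/andP: m01.
  by rewrite le_max lexx orbT; case/andP: m01.
(* By monotonicity [y] may be raised to [Num.max y (1 - e)], where the prefix is already the
   quasi-greedy one. *)
move=> y /andP[y0 y1]; rewrite -(fE (Num.max y (1 - e))).
- by apply: greedy_homo => //; rewrite le_max lexx.
- by rewrite le_max lexx orbT gt_max y1 gtrBl.
- by rewrite le_max y0.
Qed.

(** * The language of the beta-shift and Parry's criterion *)

Lemma near_prefix (y : infword) n :
  \forall z \near y, forall k, (k < n)%N -> z k = y k.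
Proof.
elim: n => [|n IHn]; first by near=> z.
have : \forall z \near y, z n = y n.
  have cvg_n : (fun z : infword => z n) @ y --> y n.
    exact: (@proj_continuous _ (fun=> nat) n y).
  exact: (cvg_n [set y n] (discrete_set1 _)).
move: IHn; apply: filterS2 => z eq_lt eq_n k.
by rewrite ltnS leq_eqVlt => /orP[/eqP->//|]; exact: eq_lt.
Unshelve. all: by end_near. Qed.

(** A point of the closure shares arbitrarily long prefixes with greedy expansions, and a factor at
    position [i] of the expansion of [x] is a prefix of that of [iter i beta_map x]. *)
Lemma language_beta_shift w : language (beta_shift beta) w <->
  exists2 x, 0 <= x < 1 & w = factor (greedy x) 0 (size w).
Proof.
split=> [[y Xy [i iw]]|[x x01 ->]].
  have [_ [[x x01 <-]]] := Xy _ (near_prefix y (i + size w)).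
  rewrite d_greedy// => eq_xy; exists (iter i beta_map x).
    exact: iter_beta_map_itv.
  rewrite -factor_greedy_iter -[LHS]iw; apply: eq_factor => k kw.
  by rewrite eq_xy// ltn_add2l.
exists (d_ beta x); first by apply: subset_closure; exists x.
by exists 0%N; rewrite size_factor d_greedy.
Qed.

Lemma language_dstar_factor i m :
  language (beta_shift beta) (factor (dstar beta) i m).
Proof.
rewrite dstarE; have [x [x01 xE _]] := factor_quasi_greedy (i + m).
apply/language_beta_shift; exists (iter i beta_map x).
  exact: iter_beta_map_itv.
move/eqP: xE; rewrite !factor_cat eqseq_cat ?size_factor// => /andP[_ /eqP <-].
by rewrite -factor_greedy_iter.
Qed.

(** Inverse branch of [beta_map] for the digit [a]; the bound [a%:R + y < beta] keeps the preimage
    below 1. *)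
Lemma greedy_cons a y : a%:R + y < beta -> 0 <= y < 1 ->
  let x := (a%:R + y) / beta in
  [/\ 0 <= x < 1, greedy x 0%N = a & beta_map x = y].
Proof.
move=> ay /andP[y0 y1] x; have bx : beta * x = a%:R + y.
  by rewrite /x mulrC divfK// gt_eqF.
have ta : Num.truncn (a%:R + y) = a.
  by apply: truncn_def; rewrite lerDl y0 -natr1 ltrD2l.
rewrite /beta_map /greedy /= bx ta addrC addKr; split=> //.
by rewrite divr_ge0 ?addr_ge0// ?(ltW beta_gt0)//= ltr_pdivrMr// mul1r.
Qed.

(** Suffixes of words in the language are prefixes of greedy expansions, hence bounded by the
    quasi-greedy prefix. Conversely, a point expanding to an admissible word is built by prepending
    letters through [greedy_cons]. *)
Lemma language_admissible w :
  language (beta_shift beta) w <-> admissible (dstar beta) w.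
Proof.
rewrite dstarE language_beta_shift; split=> [[x x01 wE] s t stE|].
  have [_ [_ _ ]] := factor_quasi_greedy (size t).
  move=> /(_ _ (iter_beta_map_itv (size s) x01)).
  rewrite -factor_greedy_iter; move/eqP: wE; rewrite stE size_cat.
  by rewrite factor_cat eqseq_cat ?size_factor// => /andP[_ /eqP <-].
elim: w => [|a w IHw] adm; first by exists 0; rewrite ?lexx ?ltr01.
have [|y y01 wE] := IHw; first exact: (@admissible_catr _ [:: a]).
suff [ay|[x x01 xE]] : a%:R + y < beta \/
    exists2 x, 0 <= x < 1 & a :: w = factor (greedy x) 0 (size w).+1.
- have [x01 xa xy] := greedy_cons ay y01.
  eexists; first exact: x01.
  by rewrite factor_cons xa factor_greedy_iter/= xy -wE.
- by exists x.
have := adm [::] _ erefl; rewrite /= [X in _ <=w X]factor_cons lexi_cons.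
rewrite [X in X && _]leq_eqVlt andb_orl =>
  /orP[/andP[/eqP aE]|/andP[a_lt _]]; last first.
  (* If [a] is below the first quasi-greedy digit, then [a + 1] is at most that digit, which is
     strictly less than [beta]. *)
  left; have /andP[dq0 _] := quasi_digit_itv (mulr_gt0 beta_gt0 ltr01).
  rewrite mulr1 in dq0; apply: lt_trans dq0.
  apply: lt_le_trans (_ : a.+1%:R <= _).
    by rewrite -natr1 ltrD2l; case/andP: y01.
  by rewrite ler_nat -[beta]mulr1.
rewrite aE lexx/= => le_w.
have [x [x01 xE _]] := factor_quasi_greedy (size w).+1.
move: xE; rewrite !factor_cons => -[x_0 x_1].
move: le_w; rewrite le_eqVlt => /orP[/eqP wE'|lt_w].
  (* The whole word is a quasi-greedy prefix, realised by the point [x] near 1. *)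
  by right; exists x => //; rewrite factor_cons x_0 x_1 -aE -wE'.
(* A strictly smaller prefix forces [y < beta_map x], so [a%:R + y < beta * x < beta]. *)
left; have yx : y < beta_map x.
  rewrite ltNge; apply/negP => xy.
  have x'0 : 0 <= beta_map x by case/andP: (iter_beta_map_itv 1 x01).
  have := @greedy_homo (size w) (beta_map x) y x'0 xy.
  by rewrite -(factor_greedy_iter x 1) x_1 -wE leNgt lt_w.
have /andP[x0 x1] := x01.
have : y + (Num.truncn (beta * x))%:R < beta * x.
  by move: yx; rewrite /beta_map ltrBrDr.
rewrite -[Num.truncn _]/(greedy x 0%N) x_0 addrC => /lt_trans; apply.
by rewrite gtr_pMr.
Qed.

End Greedy.

Theorem corollary3p19 (R : realType) (beta : R) (n : nat) :
  1 < beta -> ~ sofic (beta_shift beta) -> (0 < n)%N ->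
  (complexity n (dstar beta)
     <= set_card (extender_sets (beta_shift beta) n)
     <= n.+1 * complexity n (dstar beta))%N.
Proof.
move=> beta_gt1 _ _; apply/andP; split.
- apply: complexity_le_extender_sets; first exact: language_admissible.
  exact: language_dstar_factor.
- apply: extender_sets_le_complexity; first exact: language_admissible.
  exact: language_dstar_factor.
Qed.
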